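(* The Lipschitz distance between the cloud $[\mathbb{R}]$ of the real line and the cloud $[\Delta_1]$ of the one-point metric space, both equipped with the Gromov–Hausdorff distance, is positive: $d_L([\mathbb{R}],[\Delta_1])>0$.
   Context: For metric spaces $X,Y$, the Gromov–Hausdorff distance $d_{GH}(X,Y)$ is the infimum of $r\ge0$ such that there exist a metric space $Z$ and subsets $X',Y'\subset Z$ isometric to $X,Y$ with Hausdorff distance $d_H(X',Y')\le r$; equivalently $2d_{GH}(X,Y)=\inf_R \operatorname{dis}R$ over correspondences $R\subset X\times Y$, where $\operatorname{dis}R=\sup\{||xx'|-|yy'||:(x,y),(x',y')\in R\}$. Working in NBG set theory, the class of all nonempty metric spaces is factored by the relation $d_{GH}(X,Y)=0$; the resulting class is partitioned into equivalence classes under $d_{GH}(X,Y)<\infty$, called clouds, and $[X]$ denotes the cloud containing $X$. Thus $[\Delta_1]$ (with $\Delta_1$ the one-point space) is the cloud of all bounded metric spaces, and $[\mathbb{R}]$ is the cloud of $\mathbb{R}$ with its standard metric. Each cloud, equipped with $d_{GH}$, is a metric class, and any two clouds are in bijection. For a map $f$ between metric classes, $\operatorname{dil}(f)=\sup_{x\ne x'} d(f(x),f(x'))/d(x,x')$; the Lipschitz distance between two clouds $A,B$ is $d_L(A,B)=\inf_f\ln\max\{\operatorname{dil}(f),\operatorname{dil}(f^{-1})\}$ over all bijections $f\colon A\to B$ with $f$ and $f^{-1}$ Lipschitz with respect to $d_{GH}$. *)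

(* Defs.v *)
From Stdlib Require Import Reals Lra ClassicalEpsilon.
From Coquelicot Require Import Coquelicot.
Open Scope R_scope.

Record MetricSpace := {
  carrier :> Type;
  point : carrier;
  dist : carrier -> carrier -> R;
  dist_eq0 : forall x y, dist x y = 0 <-> x = y;
  dist_sym : forall x y, dist x y = dist y x;
  dist_tri : forall x y z, dist x z <= dist x y + dist y z
}.

Definition correspondence (X Y : MetricSpace) (Rc : X -> Y -> Prop) : Prop :=
  (forall x, exists y, Rc x y) /\ (forall y, exists x, Rc x y).

Definition distortion (X Y : MetricSpace) (Rc : X -> Y -> Prop) : Rbar :=
  Lub_Rbar (fun t => exists x x' y y', Rc x y /\ Rc x' y' /\
                     t = Rabs (dist X x x' - dist Y y y')).

(* 2 d_GH(X,Y) = inf over correspondences of dis R (extended real; +oo if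
   every correspondence has infinite distortion). *)
Definition dGH (X Y : MetricSpace) : Rbar :=
  Glb_Rbar (fun t => exists Rc, correspondence X Y Rc /\
                     distortion X Y Rc = Finite (2 * t)).

(* Points of the quotient of the class of metric spaces by d_GH = 0:
   the equivalence class of some X, as a predicate on metric spaces. *)
Definition GHclass : Type :=
  { P : MetricSpace -> Prop | exists X, P = (fun Y => dGH X Y = Finite 0) }.

Definition member (c : GHclass) (Y : MetricSpace) : Prop := proj1_sig c Y.

Definition Cloud (X : MetricSpace) : Type :=
  { c : GHclass | exists Y, member c Y /\ dGH X Y <> p_infty }.

Definition rep (c : GHclass) : MetricSpace :=
  proj1_sig (constructive_indefinite_description _ (proj2_sig c)).

(* Gromov-Hausdorff distance on a cloud (finite there; independent of reps). *)
Definition dCloud (X : MetricSpace) (a b : Cloud X) : R :=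
  real (dGH (rep (proj1_sig a)) (rep (proj1_sig b))).

Definition dil (X Y : MetricSpace) (f : Cloud X -> Cloud Y) : Rbar :=
  Lub_Rbar (fun t => exists a b, a <> b /\
                     t = dCloud Y (f a) (f b) / dCloud X a b).

Definition dL (X Y : MetricSpace) : Rbar :=
  Glb_Rbar (fun t => exists (f : Cloud X -> Cloud Y) (g : Cloud Y -> Cloud X)
                            (a b : R),
      (forall x, g (f x) = x) /\ (forall y, f (g y) = y) /\
      dil X Y f = Finite a /\ dil Y X g = Finite b /\
      t = ln (Rmax a b)).

Definition RealLine : MetricSpace.
Proof.
  refine {| carrier := R; point := 0; dist := fun x y => Rabs (x - y) |}.
  - intros x y; split; intro H.
    + destruct (Req_dec (x - y) 0) as [h|h]; [lra|].
      exfalso; apply h; apply Rabs_eq_0; exact H.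
    + subst; rewrite Rminus_diag; apply Rabs_R0.
  - intros; apply Rabs_minus_sym.
  - intros x y z; replace (x - z) with ((x - y) + (y - z)) by ring;
    apply Rabs_triang.
Defined.

Definition OnePoint : MetricSpace.
Proof.
  refine {| carrier := unit; point := tt; dist := fun _ _ => 0 |}.
  - intros [] []; tauto.
  - reflexivity.
  - intros; lra.
Defined.

(* Main.v *)
From Pilot Require Import Defs.
From Stdlib Require Import Reals.
From Coquelicot Require Import Coquelicot.
From Stdlib Require Import Lra Lia ZArith List.
From Stdlib Require FinFun.
From Stdlib Require Import Classical ClassicalEpsilon PropExtensionality
  FunctionalExtensionality ProofIrrelevance.
                                            
Import Pilot.Defs.

                                                                    
                                                                              
                                             
                                                                               
                                                                          
                                                                               
                                                                          
                                                                           
                              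

(** The bounded cloud has a centre [p], the class of the one-point space, around which balls behave
    as in an ultrametric space: any two points within [r] of [p] are within [r] of each other
    ([dGH_le_max_OnePoint], [dCloud_OnePoint_center]). No point [z] of the cloud of the real line is
    like this: for some [r > 0] there are two points within [r] of [z] at mutual distance at least
    [5/4 * r] ([cloud_line_spread]). They come from a coarse lattice and from a line with infinitely
    many parallel copies, both within [s] of the line but at least [3/2 * s] apart
    ([dGH_lattice_striped_line]); for [s] large compared with the distance from [z] to the line,
    moving the centre from the line to [z] costs little. Let a bijection [f] and its inverse [g]
    both have dilatation at most [M], and take [z = g p]. The images of the two spread points lie
    within [M * r] of [p], hence within [M * r] of each other, and applying [g] gives
    [5/4 * r <= M * M * r]. Thus [M] is bounded below by a constant larger than 1, and its logarithm
    by a positive constant. *)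

Lemma dist_nonneg (X : MetricSpace) (x y : X) : 0 <= dist X x y.
Proof.
  pose proof (dist_tri X x y x) as H.
  rewrite (dist_sym X y x), (proj2 (dist_eq0 X x x) eq_refl) in H; lra.
Qed.

                                      

(** * The Gromov-Hausdorff distance through correspondences *)

Lemma dGH_le (X Y : MetricSpace) (Rc : X -> Y -> Prop) (r : R) :
  correspondence X Y Rc ->
  (forall x x' y y', Rc x y -> Rc x' y' ->
     Rabs (dist X x x' - dist Y y y') <= 2 * r) ->
  Rbar_le (dGH X Y) r.
Proof.
  intros Hc Hr.
  set (E := fun t => exists x x' y y', Rc x y /\ Rc x' y' /\
                     t = Rabs (dist X x x' - dist Y y y')).
  destruct (Lub_Rbar_correct E) as [Hub Hlub].
  assert (Hle : Rbar_le (Lub_Rbar E) (Finite (2 * r))).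
  { apply Hlub; intros t (x & x' & y & y' & H & H' & ->); simpl; auto. }
  (* Base points make the set of distortion values nonempty, so its supremum is not minus infinity;
     with the upper bound it is a finite real, as the definition of [dGH] requires. *)
  destruct (proj1 Hc (point X)) as [y0 Hy0].
  assert (HE : E (Rabs (dist X (point X) (point X) - dist Y y0 y0)))
    by (do 4 eexists; eauto).
  apply Hub in HE.
  destruct (Lub_Rbar E) as [l| |] eqn:El; try easy.
  destruct (Glb_Rbar_correct (fun t => exists Rc, correspondence X Y Rc /\
                     distortion X Y Rc = Finite (2 * t))) as [Hlb _].
  apply Rbar_le_trans with (Finite (l / 2)).
  - apply Hlb; exists Rc; split; [exact Hc|].
    unfold distortion; fold E; rewrite El; f_equal; lra.
  - simpl in *; lra.
Qed.

Lemma dGH_lt_correspondence (X Y : MetricSpace) (r : R) :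
  Rbar_lt (dGH X Y) r ->
  exists Rc, correspondence X Y Rc /\
    forall x x' y y', Rc x y -> Rc x' y' ->
      Rabs (dist X x x' - dist Y y y') < 2 * r.
Proof.
  intros Hlt; apply NNPP; intros Hn.
  destruct (Glb_Rbar_correct (fun t => exists Rc, correspondence X Y Rc /\
                     distortion X Y Rc = Finite (2 * t))) as [_ Hglb].
  apply (Rbar_lt_not_le _ _ Hlt), Hglb.
  intros t (Rc & Hc & Ht); simpl.
  destruct (Rle_or_lt r t) as [|Htr]; [easy|]; exfalso; apply Hn.
  exists Rc; split; [exact Hc|]; intros x x' y y' H H'.
  apply Rle_lt_trans with (2 * t); [|lra].
  change (Rbar_le (Rabs (dist X x x' - dist Y y y')) (2 * t)).
  rewrite <- Ht; apply Lub_Rbar_correct; do 4 eexists; eauto.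
Qed.

Lemma dGH_nonneg (X Y : MetricSpace) : Rbar_le 0 (dGH X Y).
Proof.
  apply Rbar_not_lt_le; intros H.
  destruct (dGH_lt_correspondence _ _ _ H) as (Rc & [Hc _] & Hd).
  destruct (Hc (point X)) as [y Hy].
  specialize (Hd _ _ _ _ Hy Hy).
  pose proof (Rabs_pos (dist X (point X) (point X) - dist Y y y)); lra.
Qed.

Lemma dGH_refl (X : MetricSpace) : dGH X X = Finite 0.
Proof.
  apply Rbar_le_antisym; [|apply dGH_nonneg].
  apply dGH_le with (Rc := eq); [split; eauto|].
  intros x x' y y' -> ->; rewrite Rminus_diag, Rabs_R0; lra.
Qed.

Lemma dGH_le_sym (X Y : MetricSpace) : Rbar_le (dGH X Y) (dGH Y X).
Proof.
  apply Rbar_not_lt_le; intros H.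
  pose proof (dGH_nonneg Y X) as H0.
  destruct (dGH Y X) as [r| |] eqn:E; try easy.
  assert (exists e, 0 < e /\ Rbar_lt (r + e) (dGH X Y)) as (e & He & Hlt).
  { destruct (dGH X Y) as [q| |]; simpl in *; try easy.
    - exists ((q - r) / 2); lra.
    - exists 1; lra. }
  destruct (dGH_lt_correspondence Y X (r + e)) as (Rc & [H1 H2] & Hd).
  { rewrite E; simpl; lra. }
  apply (Rbar_lt_not_le _ _ Hlt), dGH_le with (Rc := fun x y => Rc y x).
  - now split.
  - intros x x' y y' Hx Hx'; rewrite Rabs_minus_sym; left; auto.
Qed.

Lemma dGH_sym (X Y : MetricSpace) : dGH X Y = dGH Y X.
Proof. apply Rbar_le_antisym; apply dGH_le_sym. Qed.

Lemma dGH_triangle (X Y Z : MetricSpace) (a b : R) :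
  Rbar_le (dGH X Y) a -> Rbar_le (dGH Y Z) b -> Rbar_le (dGH X Z) (a + b).
Proof.
  intros Ha Hb; apply Rbar_not_lt_le; intros H.
  (* The infima need not be attained, so each of the two composed correspondences gets slack [e]. *)
  assert (exists e, 0 < e /\ Rbar_lt (a + b + 2 * e) (dGH X Z))
    as (e & He & Hlt).
  { destruct (dGH X Z) as [q| |]; simpl in *; try easy.
    - exists ((q - (a + b)) / 4); lra.
    - exists 1; lra. }
  destruct (dGH_lt_correspondence X Y (a + e)) as (R1 & [H1 H1'] & D1).
  { eapply Rbar_le_lt_trans; [exact Ha|simpl; lra]. }
  destruct (dGH_lt_correspondence Y Z (b + e)) as (R2 & [H2 H2'] & D2).
  { eapply Rbar_le_lt_trans; [exact Hb|simpl; lra]. }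
  apply (Rbar_lt_not_le _ _ Hlt),
    dGH_le with (Rc := fun x z => exists y, R1 x y /\ R2 y z).
  - split.
    + intros x; destruct (H1 x) as [y Hy], (H2 y) as [z Hz]; eauto.
    + intros z; destruct (H2' z) as [y Hy], (H1' y) as [x Hx]; eauto.
  - intros x x' z z' (y & Hxy & Hyz) (y' & Hxy' & Hyz').
    specialize (D1 _ _ _ _ Hxy Hxy'); specialize (D2 _ _ _ _ Hyz Hyz').
    replace (dist X x x' - dist Z z z') with
      ((dist X x x' - dist Y y y') + (dist Y y y' - dist Z z z')) by ring.
    eapply Rle_trans; [apply Rabs_triang|lra].
Qed.

(** Any correspondence with a single point has the diameter of [X] as its distortion. *)
Lemma dist_le_of_dGH_OnePoint (X : MetricSpace) (r : R) (x x' : X) :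
  Rbar_le (dGH OnePoint X) r -> dist X x x' <= 2 * r.
Proof.
  intros Hr; apply Rnot_lt_le; intros H.
  destruct (dGH_lt_correspondence OnePoint X (dist X x x' / 2))
    as (Rc & [_ Hc] & Hd).
  { eapply Rbar_le_lt_trans; [exact Hr|simpl; lra]. }
  destruct (Hc x) as [u Hu], (Hc x') as [u' Hu'].
  specialize (Hd _ _ _ _ Hu Hu'); simpl in Hd.
  rewrite Rabs_minus_sym, Rminus_0_r in Hd.
  pose proof (Rle_abs (dist X x x')); lra.
Qed.

(** The full relation works: both spaces have diameter at most [2 * r], and two numbers in
    [[0, 2 * r]] differ by at most [2 * r]. This is the property that distinguishes the one-point
    space as a centre. *)
Lemma dGH_le_max_OnePoint (X Y : MetricSpace) (r : R) :
  Rbar_le (dGH OnePoint X) r -> Rbar_le (dGH OnePoint Y) r ->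
  Rbar_le (dGH X Y) r.
Proof.
  intros HX HY; apply dGH_le with (Rc := fun _ _ => True).
  - split; intros _; [exists (point Y)|exists (point X)]; exact I.
  - intros x x' y y' _ _.
    pose proof (dist_le_of_dGH_OnePoint X r x x' HX).
    pose proof (dist_le_of_dGH_OnePoint Y r y y' HY).
    pose proof (dist_nonneg X x x'); pose proof (dist_nonneg Y y y').
    apply Rabs_le; lra.
Qed.

               

(** * Clouds as metric classes *)

Definition GHclass_of (X : MetricSpace) : GHclass :=
  exist _ (fun Y => dGH X Y = Finite 0) (ex_intro _ X eq_refl).

Lemma member_rep (c : GHclass) (Y : MetricSpace) :
  member c Y <-> dGH (rep c) Y = Finite 0.
Proof.
  unfold member, rep.
  destruct (constructive_indefinite_description _ (proj2_sig c)) as [X HX].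
  simpl; now rewrite HX.
Qed.

Lemma dGH_rep_GHclass_of (X : MetricSpace) :
  dGH (rep (GHclass_of X)) X = Finite 0.
Proof. apply member_rep, dGH_refl. Qed.

Lemma GHclass_ext (c c' : GHclass) :
  dGH (rep c) (rep c') = Finite 0 -> c = c'.
Proof.
  intros H0.
  assert (Hext : proj1_sig c = proj1_sig c').
  { apply functional_extensionality; intros Y; apply propositional_extensionality.
    change (member c Y <-> member c' Y); rewrite !member_rep.
    split; intros HY; (apply Rbar_le_antisym; [|apply dGH_nonneg]);
      rewrite <- (Rplus_0_l 0).
    - apply dGH_triangle with (rep c); [rewrite dGH_sym, H0|rewrite HY];
        apply Rbar_le_refl.
    - apply dGH_triangle with (rep c'); [rewrite H0|rewrite HY];
        apply Rbar_le_refl. }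
  destruct c as [P HP], c' as [P' HP']; simpl in Hext; subst P'.
  f_equal; apply proof_irrelevance.
Qed.

Definition cloud_rep (X : MetricSpace) (a : Cloud X) : MetricSpace :=
  rep (proj1_sig a).

Lemma dGH_cloud_rep_finite (X : MetricSpace) (a : Cloud X) :
  exists r : R, Rbar_le (dGH X (cloud_rep X a)) r.
Proof.
  unfold cloud_rep; destruct a as [c (Y & HY & Hfin)]; simpl.
  apply member_rep in HY.
  destruct (dGH X Y) as [r| |] eqn:E; [|easy|].
  - exists (r + 0); apply dGH_triangle with Y.
    + rewrite E; apply Rbar_le_refl.
    + rewrite dGH_sym, HY; apply Rbar_le_refl.
  - pose proof (dGH_nonneg X Y) as H; rewrite E in H; easy.
Qed.

(** Both representatives are at finite distance from [X], so the triangle inequality makes their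
    distance finite and [real] in [dCloud] never falls back on its default value. *)
Lemma dCloud_correct (X : MetricSpace) (a b : Cloud X) :
  dGH (cloud_rep X a) (cloud_rep X b) = Finite (dCloud X a b).
Proof.
  destruct (dGH_cloud_rep_finite X a) as [r Hr].
  destruct (dGH_cloud_rep_finite X b) as [q Hq].
  rewrite dGH_sym in Hr.
  pose proof (dGH_triangle _ _ _ _ _ Hr Hq) as H.
  pose proof (dGH_nonneg (cloud_rep X a) (cloud_rep X b)) as H0.
  unfold dCloud; fold (cloud_rep X a); fold (cloud_rep X b).
  destruct (dGH (cloud_rep X a) (cloud_rep X b)); easy.
Qed.

Lemma dCloud_nonneg (X : MetricSpace) (a b : Cloud X) : 0 <= dCloud X a b.
Proof.
  pose proof (dGH_nonneg (cloud_rep X a) (cloud_rep X b)) as H.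
  rewrite dCloud_correct in H; exact H.
Qed.

Lemma dCloud_refl (X : MetricSpace) (a : Cloud X) : dCloud X a a = 0.
Proof.
  pose proof (dCloud_correct X a a) as H; rewrite dGH_refl in H.
  now injection H.
Qed.

Lemma dCloud_eq0 (X : MetricSpace) (a b : Cloud X) : dCloud X a b = 0 -> a = b.
Proof.
  intros H0; pose proof (dCloud_correct X a b) as H; rewrite H0 in H.
  apply GHclass_ext in H; destruct a as [c Hc], b as [c' Hc']; simpl in H.
  subst c'; f_equal; apply proof_irrelevance.
Qed.

(** Allowing any [M] above the dilatation lets one constant serve both a bijection and its
    inverse. *)
Lemma dCloud_le_dil (X Y : MetricSpace) (f : Cloud X -> Cloud Y) (k M : R) :
  dil X Y f = Finite k -> k <= M ->
  forall a b, dCloud Y (f a) (f b) <= M * dCloud X a b.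
Proof.
  intros Hk HkM a b.
  destruct (classic (a = b)) as [->|Hab].
  - rewrite !dCloud_refl; lra.
  - assert (Hpos : 0 < dCloud X a b).
    { destruct (dCloud_nonneg X a b) as [|H0]; [easy|].
      now elim Hab; apply dCloud_eq0. }
    assert (Hq : dCloud Y (f a) (f b) / dCloud X a b <= k).
    { change (Rbar_le (dCloud Y (f a) (f b) / dCloud X a b) k).
      rewrite <- Hk; apply Lub_Rbar_correct; eauto. }
    apply Rle_div_l; [exact Hpos|lra].
Qed.

Lemma cloud_of_near (X Y : MetricSpace) (r : R) :
  Rbar_le (dGH X Y) r ->
  exists a : Cloud X, dGH Y (cloud_rep X a) = Finite 0.
Proof.
  intros Hr; unfold Cloud, cloud_rep.
  assert (Ha : exists Z, member (GHclass_of Y) Z /\ dGH X Z <> p_infty).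
  { exists Y; split; [apply dGH_refl|intros E; rewrite E in Hr; easy]. }
  exists (exist _ (GHclass_of Y) Ha); simpl.
  rewrite dGH_sym; apply dGH_rep_GHclass_of.
Qed.

                                                         

(** * Two spaces near the line but far from each other *)

Section Witnesses.

Variable s : R.
Hypothesis Hs : 0 < s.

Definition lattice : MetricSpace.
Proof using s Hs.
  refine {| carrier := Z; point := 0%Z;
            dist := fun m n => 2 * s * IZR (Z.abs (m - n)) |}.
  - intros m n; split.
    + intros H; apply Rmult_integral in H; destruct H as [H|H]; [lra|].
      apply eq_IZR in H; lia.
    + intros ->; rewrite Z.sub_diag; simpl; ring.
  - intros m n; do 2 f_equal; lia.
  - intros m n k; rewrite <- Rmult_plus_distr_l, <- plus_IZR.
    apply Rmult_le_compat_l; [lra|apply IZR_le; lia].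
Defined.

Definition color_dist (i j : nat) : R := if Nat.eq_dec i j then 0 else 2 * s.

(** The l1-product of the line with a countable discrete space whose distinct points are [2 * s]
    apart. Infinitely many colours are there for the pigeonhole argument against [lattice]. *)
Definition striped_line : MetricSpace.
Proof using s Hs.
  refine {| carrier := (R * nat)%type; point := (0, 0%nat);
    dist := fun p q => Rabs (fst p - fst q) + color_dist (snd p) (snd q) |};
    unfold color_dist.
  - intros [x i] [y j]; simpl; pose proof (Rabs_pos (x - y)).
    destruct (Nat.eq_dec i j) as [->|Hij]; split.
    + intros E; f_equal; apply Rminus_diag_uniq.
      destruct (Req_dec (x - y) 0) as [|Hne]; [easy|].
      apply Rabs_pos_lt in Hne; lra.
    + intros [= ->]; rewrite Rminus_diag, Rabs_R0; ring.
    + intros E; lra.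
    + now intros [= _ E].
  - intros [x i] [y j]; simpl; rewrite Rabs_minus_sym; f_equal.
    destruct (Nat.eq_dec i j), (Nat.eq_dec j i); congruence.
  - intros [x i] [y j] [z k]; simpl.
    pose proof (Rabs_triang (x - y) (y - z)) as H.
    replace (x - y + (y - z)) with (x - z) in H by ring.
    destruct (Nat.eq_dec i j), (Nat.eq_dec j k), (Nat.eq_dec i k);
      try lra; congruence.
Defined.

Lemma dGH_RealLine_lattice : Rbar_le (dGH RealLine lattice) s.
Proof.
  apply dGH_le with (Rc := fun (x : RealLine) (n : lattice) =>
    Rabs (x - 2 * s * IZR n) <= s).
  - split.
    (* Since [up t] lies in [(t, t + 1]], the shift by one half selects an integer within one half
       of [x / (2 * s)]. *)
    + intros x; destruct (archimed (x / (2 * s) - / 2)) as [H1 H2].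
      exists (up (x / (2 * s) - / 2)).
      set (n := IZR (up (x / (2 * s) - / 2))) in *.
      replace x with (2 * s * (x / (2 * s))) at 1 by (field; lra).
      apply Rabs_le; split; nra.
    + intros n; exists (2 * s * IZR n); rewrite Rminus_diag, Rabs_R0; lra.
  - intros x x' m n Hm Hn; simpl.
    rewrite abs_IZR, minus_IZR.
    replace (2 * s * Rabs (IZR m - IZR n))
      with (Rabs (2 * s * IZR m - 2 * s * IZR n)).
    2:{ rewrite <- Rmult_minus_distr_l, Rabs_mult, (Rabs_pos_eq (2 * s)); lra. }
    eapply Rle_trans; [apply Rabs_triang_inv2|].
    replace (x - x' - (2 * s * IZR m - 2 * s * IZR n))
      with ((x - 2 * s * IZR m) + - (x' - 2 * s * IZR n)) by ring.
    eapply Rle_trans; [apply Rabs_triang|].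
    rewrite Rabs_Ropp; lra.
Qed.

Lemma dGH_RealLine_striped_line : Rbar_le (dGH RealLine striped_line) s.
Proof.
  apply dGH_le with (Rc := fun (x : RealLine) (p : striped_line) => fst p = x).
  - split; [intros x; now exists (x, 0%nat)|intros p; now exists (fst p)].
  - intros x x' p p' <- <-; simpl; unfold color_dist.
    destruct Nat.eq_dec; apply Rabs_le; lra.
Qed.

Lemma bounded_pigeonhole (f : nat -> Z) (N : nat) :
  (forall i, 0 <= f i < Z.of_nat N)%Z -> exists i j, i <> j /\ f i = f j.
Proof.
  intros Hf; apply NNPP; intros Hn.
  assert (Hinj : NoDup (map (fun i => Z.to_nat (f i)) (seq 0 (S N)))).
  { apply FinFun.Injective_map_NoDup; [|apply seq_NoDup].
    intros i j E; apply NNPP; intros Hij; apply Hn; exists i, j.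
    pose proof (Hf i); pose proof (Hf j); split; [easy|lia]. }
  apply NoDup_incl_length with (l' := seq 0 N) in Hinj.
  - rewrite length_map, !length_seq in Hinj; lia.
  - intros k Hk; apply in_map_iff in Hk as (i & <- & _); apply in_seq.
    pose proof (Hf i); lia.
Qed.

                                                                         
                                                                             
                                                                              
                                                                 
(** Suppose a correspondence has distortion below [3 * s]. Over a fixed point of the line, all
    colours correspond to finitely many lattice points, so two distinct colours share their lattice
    points over [0], [s], [2 * s] and [3 * s]. Sharing sharpens the distance estimates enough to
    contradict integrality. *)
Lemma dGH_lattice_striped_line :
  Rbar_le (3 / 2 * s) (dGH lattice striped_line).
Proof.
  apply Rbar_not_lt_le; intros H.
  destruct (dGH_lt_correspondence _ _ _ H) as (Rc & [_ Hc] & Hd).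
  destruct (choice (fun p n => Rc n p) Hc) as [h Hh].
  (* [w n i] is a lattice index chosen for the point [s * n] in colour [i]. Dividing all distances
     by [s] turns the distortion bound into integer inequalities. *)
  set (w := fun (n : Z) (i : nat) => h (s * IZR n, i) : Z).
  set (c := fun i j : nat => if Nat.eq_dec i j then 0%Z else 2%Z).
  assert (Hw : forall n m i j,
    (Z.abs (n - m) + c i j - 3 < 2 * Z.abs (w n i - w m j)
       < Z.abs (n - m) + c i j + 3)%Z).
  { intros n m i j.
    specialize (Hd _ _ _ _ (Hh (s * IZR n, i)) (Hh (s * IZR m, j))).
    simpl in Hd; fold (w n i) in Hd; fold (w m j) in Hd.
    rewrite <- Rmult_minus_distr_l, Rabs_mult, (Rabs_pos_eq s) in Hd by lra.
    rewrite <- minus_IZR, <- abs_IZR in Hd.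
    replace (color_dist i j) with (s * IZR (c i j)) in Hd.
    2:{ unfold color_dist, c; destruct Nat.eq_dec; ring. }
    apply Rabs_def2 in Hd as [Hd1 Hd2].
    split; apply lt_IZR, Rmult_lt_reg_l with s; trivial;
      repeat rewrite ?minus_IZR, ?plus_IZR, ?mult_IZR; lra. }
  (* Over one point of the line, indices of two colours satisfy [2 * |difference| < 2 + 3], so they
     differ by at most 2. After the shift, [u] is a base-5 digit, and four digits leave [5^4 = 625]
     codes. *)
  set (u := fun n i => (w n i - w n 0%nat + 2)%Z).
  assert (Hu : forall n i, (0 <= u n i < 5)%Z).
  { intros n i; specialize (Hw n n i 0%nat); unfold u, c in *.
    destruct Nat.eq_dec; lia. }
  destruct (bounded_pigeonhole
    (fun i => u 0 i + 5 * (u 1 i + 5 * (u 2 i + 5 * u 3 i)))%Z 625)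
    as (i & j & Hij & E).
  { intros i; pose proof (Hu 0%Z i); pose proof (Hu 1%Z i);
    pose proof (Hu 2%Z i); pose proof (Hu 3%Z i); lia. }
  assert (Ew : w 0%Z i = w 0%Z j /\ w 1%Z i = w 1%Z j /\
               w 2%Z i = w 2%Z j /\ w 3%Z i = w 3%Z j).
  { pose proof (Hu 0%Z i); pose proof (Hu 1%Z i);
    pose proof (Hu 2%Z i); pose proof (Hu 3%Z i);
    pose proof (Hu 0%Z j); pose proof (Hu 1%Z j);
    pose proof (Hu 2%Z j); pose proof (Hu 3%Z j).
    unfold u in *; lia. }
  (* Replacing [w m i] by [w m j] allows the lower bound for distinct colours, which is larger by 2;
     the upper bound remains the one for equal colours. *)
  assert (Hw' : forall n m, w m i = w m j ->
    (Z.abs (n - m) - 1 < 2 * Z.abs (w n i - w m i) < Z.abs (n - m) + 3)%Z).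
  { intros n m Em.
    pose proof (Hw n m i j) as [H1 _]; pose proof (Hw n m i i) as [_ H2].
    unfold c in *; rewrite <- Em in H1.
    destruct (Nat.eq_dec i j); [easy|].
    destruct (Nat.eq_dec i i); [lia|easy]. }
  (* Consecutive indices differ by exactly 1. Those two steps apart differ by 1 or 2, hence by 2 by
     parity, so all three steps have the same sign and the outer indices differ by 3; but the bounds
     for [0] and [3] force a difference of 2. *)
  pose proof (Hw' 0 1)%Z; pose proof (Hw' 1 2)%Z; pose proof (Hw' 2 3)%Z;
  pose proof (Hw' 0 2)%Z; pose proof (Hw' 1 3)%Z; pose proof (Hw' 0 3)%Z.
  lia.
Qed.

End Witnesses.

                               

(** * Comparing balls in the two clouds *)

Lemma cloud_line_spread (z : Cloud RealLine) :
  exists (x y : Cloud RealLine) (r : R), 0 < r /\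
    dCloud RealLine z x <= r /\ dCloud RealLine z y <= r /\
    5 / 4 * r <= dCloud RealLine x y.
Proof.
  destruct (dGH_cloud_rep_finite _ z) as [D HD].
  assert (HD0 : 0 <= D) by exact (Rbar_le_trans _ _ _ (dGH_nonneg _ _) HD).
  rewrite dGH_sym in HD.
  (* With [D] bounding the distance from the line to [z], the radius is [r = D + s]. As
     [D <= s / 5], it is at most [6/5 * s], and [5/4 * 6/5 = 3/2] matches the separation of the two
     witnesses; the extra 5 keeps [s] positive when [D = 0]. *)
  assert (Hs : 0 < 5 * D + 5) by lra; set (s := 5 * D + 5) in *.
  pose proof (dGH_RealLine_lattice s Hs) as HX.
  pose proof (dGH_RealLine_striped_line s Hs) as HY.
  destruct (cloud_of_near _ _ _ HX) as [x Hx].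
  destruct (cloud_of_near _ _ _ HY) as [y Hy].
  assert (Hx0 : Rbar_le (dGH (lattice s Hs) (cloud_rep _ x)) 0)
    by (rewrite Hx; apply Rbar_le_refl).
  assert (Hy0 : Rbar_le (dGH (cloud_rep _ y) (striped_line s Hs)) 0)
    by (rewrite dGH_sym, Hy; apply Rbar_le_refl).
  assert (Hy0' : Rbar_le (dGH (striped_line s Hs) (cloud_rep _ y)) 0)
    by (rewrite Hy; apply Rbar_le_refl).
  exists x, y, (D + (s + 0)); repeat split; [lra| | |].
  - change (Rbar_le (dCloud RealLine z x) (D + (s + 0))).
    rewrite <- dCloud_correct; eauto using dGH_triangle.
  - change (Rbar_le (dCloud RealLine z y) (D + (s + 0))).
    rewrite <- dCloud_correct; eauto using dGH_triangle.
  - assert (Hxy : Rbar_le (dGH (cloud_rep _ x) (cloud_rep _ y))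
                          (dCloud RealLine x y))
      by (rewrite dCloud_correct; apply Rbar_le_refl).
    pose proof (dGH_triangle _ _ _ _ _ Hx0 (dGH_triangle _ _ _ _ _ Hxy Hy0))
      as Hle.
    pose proof (Rbar_le_trans _ _ _ (dGH_lattice_striped_line s Hs) Hle) as H.
    simpl in H; unfold s in *; lra.
Qed.

Lemma dCloud_OnePoint_center :
  exists p : Cloud OnePoint, forall (a b : Cloud OnePoint) (r : R),
    dCloud OnePoint p a <= r -> dCloud OnePoint p b <= r ->
    dCloud OnePoint a b <= r.
Proof.
  destruct (cloud_of_near OnePoint OnePoint 0) as [p Hp].
  { rewrite dGH_refl; apply Rbar_le_refl. }
  exists p; intros a b r Ha Hb.
  change (Rbar_le (dCloud OnePoint a b) r); rewrite <- dCloud_correct.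
  apply dGH_le_max_OnePoint; rewrite <- (Rplus_0_l r);
    apply dGH_triangle with (cloud_rep _ p);
    rewrite ?Hp, ?dCloud_correct; simpl; lra.
Qed.

Theorem mainTheorem2 : Rbar_lt (Finite 0) (dL RealLine OnePoint).
Proof.
  apply Rbar_lt_le_trans with (Finite (ln (11 / 10))).
  { simpl; rewrite <- ln_1; apply ln_increasing; lra. }
  unfold dL; apply Glb_Rbar_correct.
  intros t (f & g & a & b & gf & fg & Ha & Hb & ->).
  set (M := Rmax a b).
  pose proof (dCloud_le_dil _ _ _ _ M Ha (Rmax_l a b)) as Hf.
  pose proof (dCloud_le_dil _ _ _ _ M Hb (Rmax_r a b)) as Hg.
  destruct dCloud_OnePoint_center as [p Hp].
  destruct (cloud_line_spread (g p)) as (x & y & r & Hr & Hx & Hy & Hxy).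
  specialize (Hg (f x) (f y)); rewrite !gf in Hg.
  pose proof (dCloud_nonneg _ (f x) (f y)).
  assert (HM : 0 < M) by nra.
  assert (Hfxy : dCloud OnePoint (f x) (f y) <= M * r).
  { apply Hp; [pose proof (Hf (g p) x) as H1|pose proof (Hf (g p) y) as H1];
      rewrite fg in H1; nra. }
  assert (HM2 : 5 / 4 <= M * M).
  { apply Rmult_le_reg_r with r; [exact Hr|nra]. }
  (* [(11/10)^2 = 1.21] is below [5/4], so [M * M >= 5/4] with [M > 0] gives [M >= 11/10]. *)
  simpl; apply ln_le; [lra|nra].
Qed.
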